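(* Let $R,k$ be real numbers and let $r=k^3$. Then the function $$u(x,t)=R\,e^{kx}\,C_0(rt)$$ is a solution of the KdV-like equation $$-\,{}_L\widehat{D}_t u+\left(\frac{2u_{xx}}{u}\right)u_x-u_{xxx}=0.$$
   Context: Here $u=u(x,t)$ is a function of two real variables, and subscripts $x$ denote partial derivatives in $x$. The Laguerre derivative in the variable $t$ is the operator $${}_L\widehat{D}_t:=-\frac{\partial}{\partial t}\,t\,\frac{\partial}{\partial t},\qquad\text{i.e. } {}_L\widehat{D}_t u=-\frac{\partial}{\partial t}\left(t\,\frac{\partial u}{\partial t}\right).$$ The function $C_0$ is the $0$-th order Tricomi function (Laguerre exponential function) $$C_0(x)=\sum_{j=0}^{\infty}\frac{(-1)^j x^j}{(j!)^2}.$$ Because of the quotient $u_{xx}/u$, the equation is understood at points where $u\neq 0$. *)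

(* Defs.v *)
From Stdlib Require Import Reals Factorial Lra Lia.
From Coquelicot Require Import Coquelicot.
Open Scope R_scope.

Definition C0 (x : R) : R :=
  Series (fun j : nat => (-1) ^ j * x ^ j / (INR (fact j)) ^ 2).

(** [Series] is a total operator; this shows that in [C0] it is the sum of a
    convergent series for every real argument. *)
Lemma ex_series_C0 (x : R) :
  ex_series (fun j : nat => (-1) ^ j * x ^ j / (INR (fact j)) ^ 2).
Proof.
apply (@ex_series_le R_AbsRing R_CompleteNormedModule _ (fun j => Rabs x ^ j * / INR (fact j))).
- intros j.
  assert (H1 : 1 <= INR (fact j)).
  { apply (le_INR 1). apply lt_O_fact. }
  change (norm ((-1) ^ j * x ^ j / INR (fact j) ^ 2))
    with (Rabs ((-1) ^ j * x ^ j / INR (fact j) ^ 2)).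
  unfold Rdiv.
  rewrite !Rabs_mult, pow_1_abs, Rmult_1_l, <- RPow_abs.
  rewrite (Rabs_pos_eq (/ _)) by (left; apply Rinv_0_lt_compat, pow_lt; lra).
  apply Rmult_le_compat_l; [apply pow_le, Rabs_pos|].
  apply Rinv_le_contravar; nra.
- exists (exp (Rabs x)).
  apply (is_series_ext (fun j => scal (pow_n (Rabs x) j) (/ INR (fact j)))).
  + intros j. now rewrite pow_n_pow.
  + exact (is_exp_Reals (Rabs x)).
Qed.

(** Functions [u : R -> R -> R] take the space variable [x] first and the time
    variable [t] second. *)
Definition Dx (n : nat) (u : R -> R -> R) (x t : R) : R :=
  Derive_n (fun y => u y t) n x.

Definition Dt (u : R -> R -> R) (x t : R) : R :=
  Derive (fun s => u x s) t.

Definition laguerre_Dt (u : R -> R -> R) (x t : R) : R :=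
  - Derive (fun s => s * Dt u x s) t.

(** [Derive] and [Derive_n] are total, so the existence of every derivative
    occurring in the equation has to be required separately. *)
Definition has_derivatives_at (u : R -> R -> R) (x t : R) : Prop :=
  locally x (fun y =>
    forall n : nat, (n <= 3)%nat -> ex_derive_n (fun z => u z t) n y) /\
  locally t (fun s => ex_derive (fun s' => u x s') s) /\
  ex_derive (fun s => s * Dt u x s) t.

(** Because of the quotient [u_xx / u], the equation is imposed exactly at the
    points where [u] does not vanish. *)
Definition kdv_like_solution (u : R -> R -> R) : Prop :=
  forall x t : R, u x t <> 0 ->
    has_derivatives_at u x t /\
    - laguerre_Dt u x t + (2 * Dx 2 u x t / u x t) * Dx 1 u x t - Dx 3 u x t
      = 0.

(* Main.v *)
Require Import Defs.
From Stdlib Require Import Reals.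
From Coquelicot Require Import Coquelicot.
From Stdlib Require Import Factorial Lra.
Open Scope R_scope.

(** The solution separates the variables, and each factor is an eigenfunction
    of the operators acting on it.  In [x], the exponential satisfies
    [u_x = k u], so [u_xx / u * u_x] and [u_xxx] both equal [k ^ 3 * u]
    wherever [u] does not vanish ([Derive_n_exp_scal]).  In [t], the Laguerre
    derivative sends [t ^ j] to [- j ^ 2 * t ^ (j - 1)], which shifts the
    coefficients [(-1) ^ j / (j!) ^ 2] of [C0] by one place and leaves them
    otherwise unchanged: [(t * C0'(t))' = - C0 t] ([is_derive_laguerre_C0]).
    Rescaling by [r] gives the eigenvalue [r], and the equation reduces to
    [(- r + 2 * k ^ 3 - k ^ 3) * u = 0], which holds since [r = k ^ 3]. *)

Definition C0_coeff (j : nat) : R := (-1) ^ j / INR (fact j) ^ 2.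

Lemma C0_PSeries (x : R) : C0 x = PSeries C0_coeff x.
Proof.
apply Series_ext; intros j; unfold C0_coeff, Rdiv; ring.
Qed.

(** At a point beyond a finite radius of convergence the terms of the series
    would not tend to [0], although it converges at every point. *)
Lemma CV_radius_C0_coeff : CV_radius C0_coeff = p_infty.
Proof.
assert (Hlim : forall x, is_lim_seq (fun n => C0_coeff n * x ^ n) 0).
{ intros x. apply ex_series_lim_0.
  apply (ex_series_ext (fun j => (-1) ^ j * x ^ j / INR (fact j) ^ 2)).
  - intros j. change ((-1) ^ j * x ^ j / INR (fact j) ^ 2 = C0_coeff j * x ^ j).
    unfold C0_coeff, Rdiv. ring.
  - apply ex_series_C0. }
generalize (CV_radius_ge_0 C0_coeff).
destruct (CV_radius C0_coeff) as [c| |] eqn:E; simpl; intros Hc.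
- exfalso. apply (CV_disk_outside C0_coeff (c + 1)); [|apply Hlim].
  rewrite E; simpl. rewrite Rabs_pos_eq; lra.
- reflexivity.
- contradiction.
Qed.

Lemma is_derive_C0 (x : R) : is_derive C0 x (PSeries (PS_derive C0_coeff) x).
Proof.
apply (is_derive_ext (PSeries C0_coeff)).
- intros y. symmetry. apply C0_PSeries.
- apply is_derive_PSeries. rewrite CV_radius_C0_coeff. exact I.
Qed.

(** Differentiating, multiplying by the variable and differentiating again
    multiplies the coefficient of index [n + 1] by [(n + 1) ^ 2] and moves it
    to index [n]; the factor cancels against [((n + 1)!) ^ 2]. *)
Lemma C0_coeff_laguerre (n : nat) :
  PS_derive (PS_incr_1 (PS_derive C0_coeff)) n = PS_opp C0_coeff n.
Proof.
change (INR (S n) * (INR (S n) * C0_coeff (S n)) = - C0_coeff n).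
unfold C0_coeff.
rewrite fact_simpl, mult_INR, <- tech_pow_Rmult.
field. split; [apply INR_fact_neq_0 | apply not_0_INR; discriminate].
Qed.

(** The series may be differentiated term by term everywhere, so this is the
    coefficient identity above. *)
Lemma is_derive_laguerre_C0 (x : R) :
  is_derive (fun y => y * Derive C0 y) x (- C0 x).
Proof.
apply (is_derive_ext (PSeries (PS_incr_1 (PS_derive C0_coeff)))).
- intros y. rewrite PSeries_incr_1. f_equal.
  symmetry. apply is_derive_unique, is_derive_C0.
- rewrite C0_PSeries, <- PSeries_opp, <- (PSeries_ext _ _ x C0_coeff_laguerre).
  apply is_derive_PSeries.
  rewrite CV_radius_incr_1, CV_radius_derive, CV_radius_C0_coeff. exact I.
Qed.

Lemma Derive_n_exp_scal (a k b : R) (n : nat) (x : R) :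
  Derive_n (fun y => a * exp (k * y) * b) n x = k ^ n * (a * exp (k * x) * b).
Proof.
revert x; induction n as [|n IH]; intros x; simpl; [ring|].
rewrite (Derive_ext _ _ x IH).
apply is_derive_unique. auto_derive; [exact I|ring].
Qed.

Lemma ex_derive_n_exp_scal (a k b : R) (n : nat) (x : R) :
  ex_derive_n (fun y => a * exp (k * y) * b) n x.
Proof.
destruct n as [|n]; [exact I|].
apply (ex_derive_ext (fun y => k ^ n * (a * exp (k * y) * b))).
- intros y. symmetry. apply Derive_n_exp_scal.
- auto_derive. exact I.
Qed.

Lemma is_derive_C0_scal (a r t : R) :
  is_derive (fun s => a * C0 (r * s)) t (a * (r * Derive C0 (r * t))).
Proof.
apply is_derive_scal, (is_derive_comp C0 (fun s => r * s)).
- apply Derive_correct. eexists. apply is_derive_C0.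
- auto_derive; [exact I|ring].
Qed.

(** The operator [d/dt t d/dt] is homogeneous of degree [- 1] in [t], so
    replacing [t] by [r * t] multiplies the eigenvalue by [r]. *)
Lemma is_derive_laguerre_C0_scal (a r t : R) :
  is_derive (fun s => s * Derive (fun s' => a * C0 (r * s')) s) t
    (- r * (a * C0 (r * t))).
Proof.
(* Grouping the factor [r] with [s] exhibits a composition with [r * s],
   which covers the case [r = 0] as well. *)
apply (is_derive_ext (fun s => a * ((r * s) * Derive C0 (r * s)))).
- intros s.
  transitivity (s * (a * (r * Derive C0 (r * s)))); [simpl; ring|].
  f_equal. symmetry. apply is_derive_unique, is_derive_C0_scal.
- replace (- r * (a * C0 (r * t))) with (a * (r * - C0 (r * t))) by ring.
  apply is_derive_scal.
  apply (is_derive_comp (fun y => y * Derive C0 y) (fun s => r * s)).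
  + apply is_derive_laguerre_C0.
  + auto_derive; [exact I|ring].
Qed.

Theorem mainTheorem3 (R0 k r : R) (hr : r = k ^ 3) :
  kdv_like_solution (fun x t : R => R0 * exp (k * x) * C0 (r * t)).
Proof.
intros x t Hu.
pose proof (is_derive_laguerre_C0_scal (R0 * exp (k * x)) r t) as HL.
split.
- split; [|split].
  + apply filter_forall. intros y n _. apply ex_derive_n_exp_scal.
  + apply filter_forall. intros s. eexists. apply is_derive_C0_scal.
  + eexists. exact HL.
- replace (laguerre_Dt _ x t) with (r * (R0 * exp (k * x) * C0 (r * t))).
  + unfold Defs.Dx. rewrite !Derive_n_exp_scal, hr.
    rewrite hr in Hu. field.
    repeat split; intros H0; apply Hu; rewrite H0; ring.
  + transitivity (- (- r * (R0 * exp (k * x) * C0 (r * t)))); [ring|].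
    unfold laguerre_Dt. f_equal. symmetry. apply is_derive_unique, HL.
Qed.
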